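(* There exists a finite simple undirected graph $G$ such that $$\max\{\psi_d(\vec G):\ \vec G \text{ is an orientation of } G\}<\psi(G).$$
   Context: For a graph $G$, the local chromatic number is $\psi(G):=\min_c \max_{v\in V(G)} |\{c(u): u\in N(v)\}|+1$, where the minimum is over all proper vertex colorings $c$ of $G$ (with any number of colors) and $N(v)$ is the set of neighbors of $v$. For a directed graph $D$, a proper coloring of $D$ is a proper coloring of its underlying undirected graph, and the directed local chromatic number is $\psi_d(D):=\min_c\max_{v\in V(D)}|\{c(u): u\in N_+(v)\}|+1$, where $c$ runs over proper colorings of $D$ and $N_+(v)$ is the set of out-neighbors of $v$ (vertices $w$ with an arc from $v$ to $w$). An orientation $\vec G$ of $G$ is a digraph containing each edge of $G$ with exactly one of its two possible orientations and no other arcs. *)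

(* Defs.v *)
From HB Require Import structures.
From mathcomp Require Import all_boot.
From mathcomp Require Import boolp.
Set Implicit Arguments.
Unset Strict Implicit.
Unset Printing Implicit Defensive.

Record sgraph := SGraph {
  vertex :> finType;
  edge : rel vertex;
  edge_sym : symmetric edge;
  edge_irr : irreflexive edge }.

Definition loopless (V : finType) (A : {set V * V}) : bool :=
  [forall v, (v, v) \notin A].

(* Pairs of opposite arcs are allowed. As a subtype of a finite type,
   [digraph V] is itself a finite type. *)
Definition digraph (V : finType) := {A : {set V * V} | loopless A}.

Definition arc (V : finType) (D : digraph V) : rel V :=
  fun u v => (u, v) \in val D.

Definition underlying (V : finType) (D : digraph V) : rel V :=
  fun u v => arc D u v || arc D v u.

Lemma arc_irr (V : finType) (D : digraph V) : irreflexive (arc D).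
Proof. by move=> v; apply/negbTE; move/forallP: (valP D) => /(_ v). Qed.

Lemma underlying_irr (V : finType) (D : digraph V) :
  irreflexive (underlying D).
Proof. by move=> v; rewrite /underlying arc_irr. Qed.

(* Colors are arbitrary natural numbers, so their number is not bounded. *)
Definition proper_coloring (V : finType) (e : rel V) (c : V -> nat) : Prop :=
  forall u v, e u v -> c u <> c v.

Definition num_colors (V : finType) (c : V -> nat) (A : {set V}) : nat :=
  size (undup [seq c u | u in A]).

Definition nbrs (G : sgraph) (v : G) : {set G} := [set u | edge v u].

Definition out_nbrs (V : finType) (D : digraph V) (v : V) : {set V} :=
  [set w | arc D v w].

Definition psi_spec (G : sgraph) (n : nat) : Prop :=
  exists2 c : G -> nat, proper_coloring (@edge G) c &
    n = (\max_(v : G) num_colors c (nbrs v)) + 1.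

Definition psi_d_spec (V : finType) (D : digraph V) (n : nat) : Prop :=
  exists2 c : V -> nat, proper_coloring (underlying D) c &
    n = (\max_(v : V) num_colors c (out_nbrs D v)) + 1.

Lemma proper_coloring_ex (V : finType) (e : rel V) :
  irreflexive e -> exists c, proper_coloring e c.
Proof.
move=> eI; exists (fun v => enum_rank v : nat) => u v euv /val_inj/enum_rank_inj.
by move=> uv; rewrite uv eI in euv.
Qed.

Lemma psi_ex (G : sgraph) : exists n, `[< psi_spec G n >].
Proof.
have [c cP] := proper_coloring_ex (@edge_irr G).
by eexists; apply/asboolP; exists c.
Qed.

Lemma psi_d_ex (V : finType) (D : digraph V) : exists n, `[< psi_d_spec D n >].
Proof.
have [c cP] := proper_coloring_ex (underlying_irr D).
by eexists; apply/asboolP; exists c.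
Qed.

Definition psi (G : sgraph) : nat := ex_minn (psi_ex G).

Definition psi_d (V : finType) (D : digraph V) : nat := ex_minn (psi_d_ex D).

Definition orientation (G : sgraph) (D : digraph G) : bool :=
  [forall u, forall v,
    if edge u v then arc D u v (+) arc D v u else ~~ arc D u v].

(* Hence a maximum over the orientations of [G] never ranges over the empty
   set (where [\max] would be 0). *)
Lemma orientation_ex (G : sgraph) : exists D : digraph G, orientation D.
Proof.
pose r (v : G) : nat := enum_rank v.
pose A : {set G * G} := [set p | edge p.1 p.2 && (r p.1 < r p.2)].
have lA : loopless A by apply/forallP => v; rewrite inE /= ltnn andbF.
exists (exist _ A lA); apply/forallP => u; apply/forallP => v.
rewrite /arc /= !inE /= (edge_sym v u); case: (boolP (edge u v)) => [euv|] //=.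
have : r u != r v.
  by apply/eqP => /val_inj/enum_rank_inj uv; rewrite uv edge_irr in euv.
by case: ltngtP.
Qed.

(* Main.v *)
Require Import Defs.
From HB Require Import structures.
From mathcomp Require Import all_boot.
From mathcomp Require Import boolp.
From mathcomp Require Import zify.
Set Implicit Arguments.
Unset Strict Implicit.
Unset Printing Implicit Defensive.

(* Start from a graph G0 that is not 3-colorable but has a proper coloring with
   at most two colors in every neighborhood, and join every vertex of G0 to a
   common hub by a chain of triangles, consecutive triangles sharing one vertex.
   If every neighborhood has at most two colors, then consecutive triangles
   carry the same set of three colors, so all of G0 uses the three colors found
   around the hub, which is impossible: psi is at least 4. In an orientation,
   two consecutive shared vertices cannot both have all their neighbors as
   out-neighbors; this slack allows the color set to change completely along a
   chain of bounded length, so the local coloring of G0 extends with at most two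
   colors in every out-neighborhood. *)

Lemma num_colors_le (V : finType) (c : V -> nat) (A : {set V}) (s : seq nat) :
  (forall u, u \in A -> c u \in s) -> num_colors c A <= size (undup s).
Proof.
move=> cA; apply: uniq_leq_size; first exact: undup_uniq.
move=> m; rewrite !mem_undup => /imageP [u uA ->]; exact: cA.
Qed.

Lemma num_colors_le2 (V : finType) (c : V -> nat) (A : {set V}) x y z :
  num_colors c A <= 2 -> x \in A -> y \in A -> z \in A -> c x <> c y ->
  c z \in [:: c x; c y].
Proof.
move=> cA xA yA zA cxy; apply: contraLR cA; rewrite -ltnNge => czxy.
have -> : 3 = size [:: c z; c x; c y] by [].
apply: uniq_leq_size => [|m].
  by rewrite cons_uniq czxy /= inE andbT; apply/eqP.
by rewrite mem_undup !inE => /or3P [] /eqP ->; apply: image_f.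
Qed.

Lemma size_undup_map (T U : eqType) (f : T -> U) (s : seq T) :
  size (undup (map f s)) <= size (undup s).
Proof.
rewrite -[leqRHS](size_map f); apply: uniq_leq_size (undup_uniq _) _ => m.
by rewrite mem_undup => /mapP [t ts ->]; rewrite map_f ?mem_undup.
Qed.

(** * The graph of triples is not 3-colorable *)

(* The triple (x, y, z) stands for a vertex of color x all of whose neighbors
   have their color in {y, z}. *)
Definition triple := ('I_5 * 'I_5 * 'I_5)%type.

Definition triple_edge : rel triple := fun '(x, y, z) '(x', y', z') =>
  [&& x != x', x' \in [:: y; z] & x \in [:: y'; z']].

Lemma triple_edge_sym : symmetric triple_edge.
Proof.
by move=> [[x y] z] [[x' y'] z'] /=; rewrite eq_sym andbCA andbC andbA.
Qed.

Lemma triple_edge_irr : irreflexive triple_edge.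
Proof. by move=> [[x y] z] /=; rewrite eqxx. Qed.

Section TripleColoring.
Variable f : triple -> 'I_3.
Hypothesis f_proper : forall v w, triple_edge v w -> f v != f w.

Let F (x y : 'I_5) : {set 'I_3} :=
  [set f (x, y, z) | z : 'I_5] :|: [set f (x, z, y) | z : 'I_5].

Let F_meet x y z : f (x, y, z) \in F x y :&: F x z.
Proof. by rewrite !inE !imset_f ?orbT. Qed.

Let F_gt0 x y : 0 < #|F x y|.
Proof. by apply/card_gt0P; exists (f (x, y, y)); rewrite !inE imset_f. Qed.

(** Every triple that contributes to [F x y] is adjacent to every one that contributes to
    [F y x]. *)
Let F_disjoint x y : x != y -> [disjoint F x y & F y x].
Proof.
move=> xy; apply/pred0P => a /=; apply/negP; rewrite !inE => /andP [].
by move=> /orP [] /imsetP [z _ ->] /orP [] /imsetP [w _] /eqP; apply/negP;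
   apply: f_proper; rewrite /= xy !inE !eqxx ?orbT.
Qed.

(* Since F x y and F y x are disjoint and nonempty, one of them is a singleton
   {a}; if it is F x y, then a also belongs to all F x z. *)
Let dictator a x := [exists y, (y != x) && (F x y == [set a])].

Let dictator_mem a x z : dictator a x -> a \in F x z.
Proof.
case/existsP => y /andP [_ /eqP Fxy].
have := F_meet x y z; rewrite inE Fxy inE => /andP [/eqP ->]; exact.
Qed.

(** Disjointness leaves at most one of the five [x] without a dictator and gives distinct [x]
    distinct dictators, so three colors would have to supply four dictators. *)
Lemma triple_not_3colorable : False.
Proof.
pose D := [set x | [exists a, dictator a x]].
have D_compl : #|~: D| <= 1.
  apply/card_le1_eqP => y x; rewrite !inE => yD xD.
  apply/eqP; apply: contraT => xy.
  have : #|F x y| + #|F y x| <= 3.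
    rewrite -cardsUI (disjoint_setI0 (F_disjoint xy)) cards0 addn0.
    by rewrite -[leqRHS](card_ord 3) max_card.
  have := F_gt0 x y; have := F_gt0 y x => Fyx0 Fxy0 F3.
  have /orP [/cards1P [a Fa]|/cards1P [a Fa]] :
    (#|F x y| == 1) || (#|F y x| == 1) by lia.
    case/negP: xD; apply/existsP; exists a; apply/existsP; exists y.
    by rewrite eq_sym xy Fa eqxx.
  case/negP: yD; apply/existsP; exists a; apply/existsP; exists x.
  by rewrite xy Fa eqxx.
have D_card : #|D| <= 3.
  pose d x := odflt ord0 [pick a | dictator a x].
  have dP x : x \in D -> dictator (d x) x.
    rewrite inE /d => /existsP [a ax]; case: pickP => [b //|/(_ a)].
    by rewrite ax.
  rewrite -[leqRHS](card_ord 3); apply: (@leq_card_in _ _ d) => x y xD yD dxy.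
  apply/eqP; apply: contraT => /F_disjoint/pred0P/(_ (d x)) /=.
  by rewrite (dictator_mem y (dP x xD)) dxy (dictator_mem x (dP y yD)).
by have := cardsC D; rewrite card_ord; lia.
Qed.

End TripleColoring.

(** * The gap graph *)

(* A chain of seven triangles {2i, 2i+1, 2i+2}, consecutive ones sharing one
   vertex. Position 0 is glued to a triple and position 14 to the hub. *)
Definition chain_edge (i j : nat) : bool :=
  [|| j == i.+1, i == j.+1 | ~~ odd i && ((j == i.+2) || (i == j.+2))].

Lemma chain_edge_sym : symmetric chain_edge.
Proof. by move=> i j; rewrite /chain_edge; lia. Qed.

Lemma chain_edge_irr : irreflexive chain_edge.
Proof. by move=> i; rewrite /chain_edge; lia. Qed.

(** [None] is the hub; [Some (v, ord0)] is the triple [v] itself. *)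
Definition gap_vertex := option (triple * 'I_14).

Definition gap_edge : rel gap_vertex := fun a b =>
  match a, b with
  | Some (v, i), Some (w, j) =>
      (v == w) && chain_edge i j || [&& i == ord0, j == ord0 & triple_edge v w]
  | Some (v, i), None => chain_edge i 14
  | None, Some (w, j) => chain_edge 14 j
  | None, None => false
  end.

Lemma gap_edge_sym : symmetric gap_edge.
Proof.
case=> [[v i]|] [[w j]|] //=; try exact: chain_edge_sym.
by rewrite eq_sym chain_edge_sym triple_edge_sym andbCA.
Qed.

Lemma gap_edge_irr : irreflexive gap_edge.
Proof.
by case=> [[v i]|] //=; rewrite chain_edge_irr triple_edge_irr !andbF.
Qed.

Definition gap_graph : sgraph := SGraph gap_edge_sym gap_edge_irr.

Definition pos (v : triple) (i : nat) : gap_graph :=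
  if i < 14 then Some (v, inord i) else None.

Lemma pos_ord (v : triple) (i : 'I_14) : pos v i = Some (v, i).
Proof. by rewrite /pos ltn_ord inord_val. Qed.

Lemma pos0 (v : triple) : pos v 0 = Some (v, ord0).
Proof. exact: pos_ord v ord0. Qed.

Lemma edge_pos v i j :
  i <= 14 -> j <= 14 -> chain_edge i j -> edge (pos v i) (pos v j).
Proof.
move=> i14 j14 ij; rewrite /edge /= /pos.
case: ltnP => i_lt; case: ltnP => j_lt /=; rewrite ?inordK ?eqxx ?ij //.
- by have <- : j = 14 by lia.
- by have <- : i = 14 by lia.
by move: ij; rewrite /chain_edge; lia.
Qed.

(** * Lower bound on the local chromatic number *)

Section LocalColoring.
Variable c : gap_graph -> nat.
Hypothesis c_proper : proper_coloring (@edge gap_graph) c.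
Hypothesis c_local : forall a, num_colors c (nbrs a) <= 2.

Let col v i := c (pos v i).

Let col_neq v i j : i <= 14 -> j <= 14 -> chain_edge i j -> col v i <> col v j.
Proof. by move=> i14 j14 ij; apply/c_proper/edge_pos. Qed.

(** The shared vertex sees both triangles; its two neighbors in the next one are adjacent, so their
    colors are already the two it may see. *)
Let triangle_step v i : i < 6 ->
  {subset [:: col v i.*2; col v i.*2.+1; col v i.*2.+2]
       <= [:: col v i.*2.+2; col v i.*2.+3; col v i.*2.+4]}.
Proof.
move=> i6 m.
have H j : j <= 14 -> chain_edge i.*2.+2 j -> pos v j \in nbrs (pos v i.*2.+2).
  by move=> j14 ij; rewrite inE edge_pos //; lia.
have K j : j <= 14 -> chain_edge i.*2.+2 j ->
    col v j \in [:: col v i.*2.+3; col v i.*2.+4].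
  move=> j14 ij; apply: num_colors_le2 (c_local (pos v i.*2.+2)) _ _ _ _.
  - by apply: H; rewrite /chain_edge; lia.
  - by apply: H; rewrite /chain_edge; lia.
  - exact: H.
  by apply: col_neq; rewrite /chain_edge; lia.
rewrite in_cons [X in _ || X]in_cons inE => /or3P [] /eqP ->.
- by rewrite inE K ?orbT // /chain_edge; lia.
- by rewrite inE K ?orbT // /chain_edge; lia.
by rewrite inE eqxx.
Qed.

Let col_end v : col v 0 \in [:: col v 12; col v 13; col v 14].
Proof.
have t := @triangle_step v.
have := mem_head (col v 0) [:: col v 1; col v 2].
by move=> /(t 0 isT)/(t 1 isT)/(t 2 isT)/(t 3 isT)/(t 4 isT)/(t 5 isT).
Qed.

Lemma gap_not_local3 : False.
Proof.
pose v0 : triple := (ord0, ord0, ord0).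
pose S := [:: col v0 12; col v0 13; col v0 14].
have hub v j : j \in [:: 12; 13] -> col v j \in [:: col v0 12; col v0 13].
  have nb w k : k \in [:: 12; 13] -> pos w k \in nbrs (pos v0 14).
    by rewrite !inE => /orP [] /eqP ->; exact: (@edge_pos w 14).
  move=> jP; apply: num_colors_le2 (c_local (pos v0 14)) _ _ _ _.
  - exact: nb.
  - exact: nb.
  - exact: nb.
  exact: col_neq.
have colS v : col v 0 \in S.
  have := col_end v; rewrite !inE => /or3P [] /eqP ->.
  - by have := hub v 12 isT; rewrite !inE => /orP [] ->; rewrite ?orbT.
  - by have := hub v 13 isT; rewrite !inE => /orP [] ->; rewrite ?orbT.
  by rewrite eqxx !orbT.
pose f v : 'I_3 := inord (index (col v 0) S).
apply: (@triple_not_3colorable f) => v w vw; apply/eqP => fvw.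
have colvw : col v 0 <> col w 0.
  by apply: c_proper; rewrite !pos0 /= vw orbT.
have idx u : index (col u 0) S = f u by rewrite inordK // index_mem.
by apply: colvw; rewrite -(nth_index 0 (colS v)) idx fvw -idx nth_index.
Qed.

End LocalColoring.

Lemma gap_psi : 3 < psi gap_graph.
Proof.
rewrite /psi; case: ex_minnP => n /asboolP [c cP ->] _.
rewrite addn1 ltnS ltnNge; apply/negP => /bigmax_leqP c_local.
by apply: (gap_not_local3 cP) => a; exact: c_local.
Qed.

(** * Color patterns along an oriented chain *)

(* [d] lists the directions of the edges between even positions. The edges to
   odd positions are taken to be outgoing: odd positions have degree 2 and
   hence never violate the bound. *)
Definition chain_out (d : seq bool) (i j : nat) : bool :=
  chain_edge i j &&
  [|| odd i, odd j, (j == i.+2) && nth false d i./2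
                  | (i == j.+2) && ~~ nth false d j./2].

Definition chain_outs d i := [seq j <- iota 0 15 | chain_out d i j].

(* Symbol 0 is the color of the triple at position 0, symbols 1 and 2 are the
   colors of its neighbors, 3 is the color of the hub and 4, 5 those of the
   neighbors of the hub. *)
Definition chain_pattern_ok (d : seq bool) (p : seq nat) : bool :=
  [&& all (fun i => size (undup (map (nth 0 p) (chain_outs d i))) <= 2)
        (iota 1 13),
      all (fun i => all (fun j => chain_edge i j ==> (nth 0 p i != nth 0 p j))
        (iota 0 15)) (iota 0 15),
      all (fun m => m < 6) p,
      nth 0 p 0 == 0, all (fun i => nth 0 p i \in [:: 1; 2]) [:: 1; 2],
      all (fun i => nth 0 p i \in [:: 4; 5]) [:: 12; 13] & nth 0 p 14 == 3].

(* Found by computer search; seven is the least number of triangles for which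
   every orientation of the chain admits a pattern. *)
Definition chain_patterns : seq (seq nat) :=
  [:: [:: 0; 2; 1; 2; 5; 2; 3; 5; 2; 5; 3; 5; 4; 5; 3];
      [:: 0; 1; 2; 1; 0; 1; 5; 1; 4; 5; 1; 5; 4; 5; 3];
      [:: 0; 2; 1; 0; 2; 0; 1; 5; 0; 5; 3; 5; 4; 5; 3];
      [:: 0; 2; 1; 2; 4; 1; 2; 1; 4; 5; 1; 5; 4; 5; 3];
      [:: 0; 2; 1; 2; 5; 2; 1; 5; 4; 5; 1; 5; 4; 5; 3];
      [:: 0; 2; 1; 2; 0; 5; 3; 5; 0; 5; 3; 5; 4; 5; 3];
      [:: 0; 2; 1; 0; 2; 0; 1; 3; 0; 1; 3; 5; 4; 5; 3];
      [:: 0; 1; 2; 0; 1; 4; 0; 1; 4; 5; 1; 5; 4; 5; 3]].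

Lemma chain_pattern_ex (d : seq bool) :
  size d = 7 -> has (chain_pattern_ok d) chain_patterns.
Proof.
case: d => [|b0 [|b1 [|b2 [|b3 [|b4 [|b5 [|b6 [|]]]]]]]] // _.
by case: b0; case: b1; case: b2; case: b3; case: b4; case: b5; case: b6;
   vm_compute.
Qed.

(** * Upper bound for every orientation *)

Section DirectedColoring.
Variable D : digraph gap_graph.
Hypothesis D_orientation : orientation D.

Let arc_edge a b : Defs.arc D a b -> edge a b.
Proof.
move/forallP: D_orientation => /(_ a) /forallP /(_ b).
by case: ifP => // _ /negbTE ->.
Qed.

Let edge_arc a b : edge a b -> Defs.arc D b a = ~~ Defs.arc D a b.
Proof.
move/forallP: D_orientation => /(_ a) /forallP /(_ b) h ab.
by move: h; rewrite ab; case: (Defs.arc D a b); case: (Defs.arc D b a).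
Qed.

Let dirs v := [seq Defs.arc D (pos v i.*2) (pos v i.*2.+2) | i <- iota 0 7].

Let pattern v := nth [::] chain_patterns
  (find (chain_pattern_ok (dirs v)) chain_patterns).

Let patternP v : chain_pattern_ok (dirs v) (pattern v).
Proof. by apply: nth_find; apply: chain_pattern_ex; rewrite size_map. Qed.

(* The default colors 8 and 9 keep the palette injective on degenerate
   triples. *)
Let palette (v : triple) : seq nat := let: (x, y, z) := v in
  [:: x : nat; if y == x then 8 else y; if z \in [:: x; y] then 9 else z;
      5; 6; 7].

Let palette_uniq v : uniq (palette v).
Proof.
case: v => [[x y] z]; have E (a b : 'I_5) : (a == b) = (a == b :> nat) by [].
have := ltn_ord x; have := ltn_ord y; have := ltn_ord z.
rewrite /palette !inE !E.
by case: ifP => yx; case: ifP => zxy; rewrite /= !inE; lia.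
Qed.

Let color v i := nth 0 (palette v) (nth 0 (pattern v) i).

Let c (a : gap_graph) : nat := if a is Some (v, i) then color v i else 5.

(** Symbol 3 is color 5 in every palette, so all chains agree at the hub. *)
Let color14 v : color v 14 = 5.
Proof.
by rewrite /color; case/and5P: (patternP v) => _ _ _ _ /and3P [_ _ /eqP ->];
   case: v => [[]].
Qed.

Let color0 v : color v 0 = v.1.1.
Proof.
by rewrite /color; case/and5P: (patternP v) => _ _ _ /eqP -> _; case: v => [[]].
Qed.

Let c_pos v i : i <= 14 -> c (pos v i) = color v i.
Proof.
move=> i14; rewrite /pos; case: ltnP => ilt /=; first by rewrite inordK.
by rewrite (_ : i = 14) ?color14 //; lia.
Qed.

Let color_neq v i j :
  i <= 14 -> j <= 14 -> chain_edge i j -> color v i <> color v j.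
Proof.
move=> i14 j14 ij.
case/and5P: (patternP v) => _ /allP neq /allP lt6 _ _.
have lt k : nth 0 (pattern v) k < 6.
  by case: (ltnP k (size (pattern v))) => k_lt;
     [apply/lt6/mem_nth | rewrite nth_default].
have sz : size (palette v) = 6 by case: v {neq lt6 lt} => [[]].
apply/eqP; rewrite nth_uniq ?sz ?lt ?palette_uniq //.
have /neq/allP/(_ j) : i \in iota 0 15 by rewrite mem_iota; lia.
by rewrite mem_iota ij; apply; lia.
Qed.

Let c_proper : proper_coloring (underlying D) c.
Proof.
have c_edge a b : edge a b -> c a <> c b.
  case: a => [[v i]|]; case: b => [[w j]|] //= ab.
  - case/orP: ab => [/andP [/eqP <- ij]|/and3P [/eqP -> /eqP -> vw]].
      by apply: color_neq => //; exact: ltnW.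
    rewrite !color0; case: v vw => [[x y] z]; case: w => [[x' y'] z'] /=.
    by case/andP => + _ => /eqP xx' /val_inj.
  - have := @color_neq v i 14; rewrite color14 => neq; apply: neq ab => //.
    exact: ltnW.
  have := @color_neq w 14 j; rewrite color14 => neq; apply: neq ab => //.
  exact: ltnW.
by move=> a b /orP [/arc_edge/c_edge //|/arc_edge/c_edge ba ab]; apply: ba.
Qed.

(** Neighbors of the hub sit at positions 12 and 13, where patterns use only symbols 4 and 5: colors
    6 and 7 in every palette. *)
Let c_hub : num_colors c (out_nbrs D None) <= 2.
Proof.
apply: leq_trans (num_colors_le (s := [:: 6; 7]) _) _ => // a.
rewrite inE => /arc_edge; case: a => [[v i]|] //= i14.
case/and5P: (patternP v) => _ _ _ _ /and3P [_ /allP end45 _].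
have /end45 : nat_of_ord i \in [:: 12; 13].
  by move: i14; rewrite /chain_edge !inE; have := ltn_ord i; lia.
rewrite /color; case: v {end45} => [[x y] z].
by rewrite !inE => /orP [] /eqP ->.
Qed.

Let c_triple v : num_colors c (out_nbrs D (Some (v, ord0))) <= 2.
Proof.
apply: leq_trans
  (num_colors_le (s := [:: nth 0 (palette v) 1; nth 0 (palette v) 2]) _) _.
  move=> a; rewrite inE => /arc_edge; case: a => [[w j]|] //=.
  case/orP => [/andP [/eqP <- ij]|/andP [/eqP -> vw]].
    case/and5P: (patternP v) => _ _ _ _ /and3P [/allP start12 _ _].
    have /start12 : nat_of_ord j \in [:: 1; 2].
      by move: ij; rewrite /chain_edge !inE /=; lia.
    by rewrite /color !inE => /orP [] /eqP ->; rewrite eqxx ?orbT.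
  rewrite color0; case: v vw => [[x y] z]; case: w => [[x' y'] z'] /=.
  case/and3P => xx' + _; rewrite !inE => /orP [] /eqP x'E; subst x'.
    by rewrite [y == x]eq_sym (negbTE xx') eqxx.
  rewrite [z == x]eq_sym (negbTE xx') /=.
  (* If [z] equals [y], the color is the first of the two; otherwise [z] differs from [x] and [y]
     and is not replaced by 9. *)
  by case: (eqVneq z y) xx' => [->|_ _]; rewrite ?eqxx ?orbT // eq_sym;
     move=> /negbTE ->; rewrite eqxx.
exact: leq_trans (size_undup _) _.
Qed.

(** All out-neighbors lie in [chain_outs (dirs v) i], where the pattern has at most two symbols, and
    applying the palette cannot increase their number. *)
Let c_chain v (i : 'I_14) :
  i != ord0 -> num_colors c (out_nbrs D (Some (v, i))) <= 2.
Proof.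
move=> i0; case/and5P: (patternP v) => /allP/(_ i) few _ _ _ _.
pose s := map (color v) (chain_outs (dirs v) i).
apply: leq_trans (num_colors_le (s := s) _) _.
  move=> a; rewrite inE => ia.
  have [k k14 aE] : exists2 k, k <= 14 & a = pos v k.
    move/arc_edge: ia; case: a => [[w j]|] /=; last by exists 14.
    rewrite (negbTE i0) orbF => /andP [/eqP -> _].
    by exists j; rewrite ?pos_ord // ltnW.
  have ik : chain_edge i k.
    move/arc_edge: ia; rewrite aE /pos; case: ltnP => k_lt /=.
      by rewrite (negbTE i0) orbF inordK // => /andP [].
    by have -> : k = 14 by lia.
  rewrite aE c_pos // map_f // mem_filter mem_iota /= add0n ltnS k14 andbT.
  rewrite /chain_out ik /=.
  have nd j : j < 7 ->
      nth false (dirs v) j = Defs.arc D (pos v j.*2) (pos v j.*2.+2).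
    by move=> j7; rewrite (nth_map 0) ?size_iota // nth_iota.
  case: (boolP (odd i)) => //= ei; case: (boolP (odd k)) => //= ek.
  move: ik; rewrite /chain_edge (negbTE ei) /= => ik.
  have {ik} [kE|iE] : k = i.+2 \/ i = k.+2 :> nat by lia.
    rewrite kE eqxx /= nd; last by have := ltn_ord i; lia.
    by rewrite even_halfK // -kE -aE pos_ord ia.
  (* The entry of [dirs v] for this edge records the arc from [k] to [i], which is absent since [D]
     has the opposite one. *)
  rewrite [X in _ || X](_ : _ = true) ?orbT // iE eqxx /=.
  rewrite nd; last by have := ltn_ord i; lia.
  by rewrite even_halfK // -iE -edge_arc ?pos_ord -?aE ?ia //;
     rewrite edge_sym arc_edge.
rewrite /s (map_comp (nth 0 (palette v)) (nth 0 (pattern v))).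
apply: leq_trans (size_undup_map _ _) _; apply: few; rewrite mem_iota.
by have := ltn_ord i; move: i0; rewrite -(inj_eq val_inj) /=; lia.
Qed.

Lemma gap_psi_d : psi_d D <= 3.
Proof.
rewrite /psi_d; case: ex_minnP => n _ min.
apply: leq_trans (min _ _) _.
  by apply/asboolP; exists c; [exact: c_proper | reflexivity].
rewrite addn1 ltnS; apply/bigmax_leqP => a _.
case: a => [[v i]|]; last exact: c_hub.
by case: (eqVneq i ord0) => [->|/c_chain].
Qed.

End DirectedColoring.

Theorem theorem1 :
  exists G : sgraph,
    \max_(D : digraph G | orientation D) psi_d D < psi G.
Proof.
exists gap_graph; apply: leq_ltn_trans gap_psi.
by apply/bigmax_leqP => D; exact: gap_psi_d.
Qed.
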